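(* Let $(V,\leq)$ be a topological vector lattice, let $\mathcal{K}_0\subset V$ be a convex cone, let $U\subset V$ be an ideal which is dense in $V$, and let $\tau$ be a topology on $U$ such that $(U,\leq)$ equipped with $\tau$ is a locally convex topological vector lattice. Let $\mathcal{C}:=(\mathcal{K}_0-V_+)\cap U$. Then the following statements are equivalent: (i) $\mathcal{K}_0$ satisfies NFL$_\tau$, that is, $\overline{\mathcal{C}}^{\tau}\cap U_+=\{0\}$. (ii) For each $x\in U_+\setminus\{0\}$ there exists a separating functional $x'\in U'_+$ for $\mathcal{C}$ such that $x'(x)>0$.
   Context: A topological vector lattice is a real vector lattice which is a Hausdorff topological vector space having a zero neighborhood basis of solid sets ($A$ is solid if $x\in A$, $|y|\leq|x|$ imply $y\in A$). An ideal is a solid linear subspace. $V_+=\{x\in V:x\geq0\}$, $U_+=V_+\cap U$. A convex cone is a nonempty set closed under $ax+by$ for $a,b\geq0$ (in particular it contains $0$). $\overline{\mathcal{C}}^{\tau}$ is the closure of $\mathcal{C}$ in $(U,\tau)$. $U'$ is the space of $\tau$-continuous linear functionals on $U$, and $U'_+$ the set of $x'\in U'$ with $x'(U_+)\subset[0,\infty)$. A functional $x'\in U'_+$ is separating for $\mathcal{C}$ if $x'(y)\leq0$ for all $y\in\mathcal{C}$. *)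

(* Defs.v *)
From HB Require Import structures.
From mathcomp Require Import all_boot all_order all_algebra.
From mathcomp Require Import all_classical all_reals all_analysis.

Set Implicit Arguments.
Unset Strict Implicit.
Unset Printing Implicit Defensive.

Import Order.TTheory GRing.Theory Num.Theory.
Import numFieldNormedType.Exports.

Local Open Scope classical_set_scope.
Local Open Scope ring_scope.

(* The lattice operations are part of this mixin rather than inherited from   *)
(* [Order.Lattice]: Hierarchy Builder rejects a join of [Order.Lattice] and   *)
(* [GRing.Zmodule] that is declared after [Num.RealDomain].                   *)
HB.mixin Record isVectorLattice (R : numDomainType) V
    & GRing.Lmodule R V & Num.POrderedZmodule V := {
  vl_join : V -> V -> V ;
  vl_meet : V -> V -> V ;
  vl_joinP : forall x y z : V, (vl_join x y <= z) = (x <= z) && (y <= z) ;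
  vl_meetP : forall x y z : V, (z <= vl_meet x y) = (z <= x) && (z <= y) ;
  vl_lerD : forall x y z : V, x <= y -> x + z <= y + z ;
  vl_scaler_ge0 : forall (a : R) (x : V), 0 <= a -> 0 <= x -> 0 <= a *: x
}.

#[short(type="vectorLatticeType")]
HB.structure Definition VectorLattice (R : numDomainType) :=
  {V of GRing.Lmodule R V & Num.POrderedZmodule V & isVectorLattice R V}.

Section VectorLatticeDefs.
Context (R : numDomainType) (V : vectorLatticeType R).

Definition vl_abs (x : V) : V := vl_join x (- x).

Definition solid (A : set V) : Prop :=
  forall x y : V, A x -> vl_abs y <= vl_abs x -> A y.

Definition linear_subspace (A : set V) : Prop :=
  A 0 /\ forall (a b : R) (x y : V), A x -> A y -> A (a *: x + b *: y).

Definition ideal (A : set V) : Prop := solid A /\ linear_subspace A.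

Definition positive_cone : set V := [set x | 0 <= x].

Definition convex_cone (K : set V) : Prop :=
  K !=set0 /\
  forall (a b : R) (x y : V),
    0 <= a -> 0 <= b -> K x -> K y -> K (a *: x + b *: y).

End VectorLatticeDefs.

Arguments positive_cone {R} V.

HB.mixin Record isTopVectorLattice (R : numDomainType) V
    & TopologicalLmodule R V & VectorLattice R V := {
  tvl_hausdorff : hausdorff_space V ;
  tvl_solid_basis : forall A : set V, nbhs (0 : V) A ->
    exists B : set V, [/\ nbhs (0 : V) B, solid B & B `<=` A]
}.

#[short(type="topVectorLatticeType")]
HB.structure Definition TopVectorLattice (R : numDomainType) :=
  {V of TopologicalLmodule R V & VectorLattice R V & isTopVectorLattice R V}.

(* Local convexity is that of [tvsType]: a basis of convex open sets.  The    *)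
(* uniform structure carried by a [tvsType] is not used, and any locally      *)
(* convex space has one (see the factory [PreTopologicalLmod_isTvs]).         *)
#[short(type="lcTopVectorLatticeType")]
HB.structure Definition LcTopVectorLattice (R : numDomainType) :=
  {V of Tvs R V & TopVectorLattice R V}.

(* A subset [P] of [V], as a type [U] with the vector space structure and the *)
(* order inherited from [V] through [\val : U -> V], and with a topology of   *)
(* its own, unrelated to that of [V], making it a locally convex topological  *)
(* vector lattice.                                                            *)
#[short(type="subLcTopVectorLatticeType")]
HB.structure Definition SubLcTopVectorLattice (R : numDomainType)
    (V : vectorLatticeType R) (P : pred V) :=
  {U of @GRing.SubLmodule R V P U
      & @Order.SubPOrder ring_display V P ring_display U
      & LcTopVectorLattice R U}.

Section NoFreeLunch.
Context (R : realType) (V : vectorLatticeType R) (P : pred V).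
Variable U : subLcTopVectorLatticeType P.

(* The cone [C := (K0 - V_+) :&: U], as a subset of [U]. *)
Definition claims (K0 : set V) : set U :=
  (\val : U -> V) @^-1` [set k - v | k in K0 & v in positive_cone V].

Definition NFL (K0 : set V) : Prop :=
  closure (claims K0) `&` positive_cone U = [set 0].

End NoFreeLunch.

Arguments claims {R V P} U K0.
Arguments NFL {R V P} U K0.

Section Functionals.
Context (R : realType) (U : lcTopVectorLatticeType R).

(* The cone [U'_+]; continuity is for the topology of [U], not that of [V]. *)
Definition dual_positive (f : {scalar U}) : Prop :=
  continuous f /\ forall x : U, positive_cone U x -> 0 <= f x.

Definition separating (C : set U) (f : {scalar U}) : Prop :=
  dual_positive f /\ forall y : U, C y -> f y <= 0.

End Functionals.

(* Main.v *)
(* A point x of U_+ \ {0} lies outside the closure of the convex cone C, so   *)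
(* some convex 0-neighborhood W satisfies (x - W) :&: C = set0. The           *)
(* functional q y = inf {t >= 0 | y in C + t W} is sublinear, nonpositive on  *)
(* C, bounded by 1 on W, and q x >= 1. A linear functional dominated by q and *)
(* equal to q at x (Hahn-Banach) is then continuous and separates x from C;   *)
(* it is positive because - U_+ is contained in C. The converse is immediate  *)
(* by continuity.                                                             *)
Require Import Defs.
From HB Require Import structures.
From mathcomp Require Import all_boot all_order all_algebra.
From mathcomp Require Import all_classical all_reals all_analysis.
From mathcomp Require Import lra.

Set Implicit Arguments.
Unset Strict Implicit.
Unset Printing Implicit Defensive.

Import Order.TTheory GRing.Theory Num.Theory.
Import numFieldNormedType.Exports.

Local Open Scope classical_set_scope.
Local Open Scope ring_scope.

(** The separating functional comes from [cone_separation], which applies [Hahn_Banach] to the gauge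
    of [C + W]. Hahn-Banach itself is proved without extending functionals from subspaces: Zorn's
    lemma gives a minimal sublinear functional below a given one ([exists_minimal_sublinear]), and a
    minimal one is linear ([minimal_sublinear_scalar]), since [sublinear_shrink] would otherwise
    lower it. *)

Section HahnBanach.
Context (R : realType) (V : lmodType R).
Implicit Types (p q : V -> R) (x y : V).

Definition sublinear p : Prop :=
  (forall x y, p (x + y) <= p x + p y) /\
  (forall (a : R) x, 0 <= a -> p (a *: x) <= a * p x).

Lemma sublinear0 p : sublinear p -> p 0 = 0.
Proof.
move=> [pD pZ]; apply/eqP; rewrite eq_le; apply/andP; split.
  by have := pZ 0 0 (lexx 0); rewrite scale0r mul0r.
by have := pD 0 0; rewrite addr0 lerDl.
Qed.

(** For [a > 0], the reverse inequality is the assumed one for [a^-1] at [a *: x]. *)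
Lemma sublinearZ p (a : R) x : sublinear p -> 0 <= a -> p (a *: x) = a * p x.
Proof.
move=> ps; rewrite le_eqVlt => /predU1P[<-|a0].
  by rewrite scale0r mul0r sublinear0.
apply/eqP; rewrite eq_le ps.2 ?(ltW a0)//= -ler_pdivlMl// -{1}[x]scale1r.
by rewrite -(mulVf (lt0r_neq0 a0)) -scalerA ps.2// invr_ge0 ltW.
Qed.

Lemma sublinear_lower p x : sublinear p -> - p (- x) <= p x.
Proof.
move=> ps; have := ps.1 x (- x).
by rewrite subrr sublinear0// -lerBlDr sub0r.
Qed.

(* [G], seen as a subset of [V * R], is a convex cone. *)
Lemma sublinear_inf (G : V -> set R) :
  (forall x, has_inf (G x)) ->
  (forall x y s t, G x s -> G y t -> G (x + y) (s + t)) ->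
  (forall (a : R) x s, 0 <= a -> G x s -> G (a *: x) (a * s)) ->
  sublinear (fun x => inf (G x)).
Proof.
move=> Ginf GD GZ.
have lbG x s : G x s -> inf (G x) <= s.
  by move=> Gs; apply: ge_inf Gs; case: (Ginf x).
have infG x b : (forall s, G x s -> b <= s) -> b <= inf (G x).
  by move=> bG; apply: lb_le_inf; [case: (Ginf x)|exact: bG].
split=> [x y|a x].
  rewrite -lerBlDr; apply/infG => s Gs.
  rewrite lerBlDr -lerBlDl; apply/infG => t Gt.
  by rewrite lerBlDl; apply/lbG/GD.
rewrite le_eqVlt => /predU1P[<-|a0].
  have [[s Gs] _] := Ginf x.
  by have := lbG _ _ (GZ 0 x s (lexx 0) Gs); rewrite !mul0r.
rewrite -ler_pdivrMl//; apply/infG => s Gs.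
by rewrite ler_pdivrMl//; apply/lbG/GZ => //; exact: ltW.
Qed.

(* [p' x] is [inf_(t >= 0) (p (x + t y) - t p y)]. Minimality of [p] forces   *)
(* [p' = p], hence additivity; evaluating at [x = - y] gives                  *)
(* [p' (- y) <= - p y], which pins the value at [y] of anything below [p'].   *)
Lemma sublinear_shrink p y : sublinear p ->
  exists p', [/\ sublinear p', forall x, p' x <= p x &
                 forall x, p' x <= p (x + y) - p y].
Proof.
move=> ps.
(* All [s] above a value are kept, so that [G] is a cone: subadditivity only bounds the value at a
   sum. *)
pose G x := [set s | exists2 t : R, 0 <= t & p (x + t *: y) - t * p y <= s].
have Ginf x : has_inf (G x).
  split; first by exists (p (x + 0 *: y) - 0 * p y); exists 0.
  (* Lower bound: [t * p y = p (t *: y) <= p (x + t *: y) + p (- x)]. *)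
  exists (- p (- x)) => s [t t0]; apply: le_trans.
  rewrite -sublinearZ// lerBrDr addrC lerBlDr.
  by rewrite (le_trans _ (ps.1 _ _))// addrAC subrr add0r.
exists (fun x => inf (G x)); split=> [|x|x].
- apply: sublinear_inf => //
    [x x' s s' [t t0 ts] [t' t'0 ts']|a x s a0 [t t0 ts]].
    exists (t + t'); first exact: addr_ge0.
    rewrite scalerDl addrACA; have := ps.1 (x + t *: y) (x' + t' *: y); lra.
  exists (a * t); first exact: mulr_ge0.
  rewrite -scalerA -scalerDr sublinearZ// -mulrA -mulrBr.
  exact: ler_wpM2l.
- apply: ge_inf; first by case: (Ginf x).
  by exists 0; rewrite // scale0r mul0r addr0 subr0.
- apply: ge_inf; first by case: (Ginf x).
  by exists 1; rewrite // scale1r mul1r.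
Qed.

Lemma exists_minimal_sublinear q : sublinear q ->
  exists p, [/\ sublinear p, forall x, p x <= q x &
    forall p', sublinear p' -> (forall x, p' x <= p x) ->
      forall x, p x <= p' x].
Proof.
move=> qs; pose T := {p : V -> R | sublinear p /\ forall x, p x <= q x}.
(* The order is reversed, so that Zorn's maximal element is a minimal functional. A preorder
   suffices, which avoids equality of dependent pairs. *)
pose below (p p' : T) := `[< forall x, sval p' x <= sval p x >].
have q0 : T by exists q.
have [|p1 p2 p3 /asboolP p12 /asboolP p23|A Atot|[p [ps pq]] pmin] :=
    ZL_preorder q0 (R := below).
- by move=> p; apply/asboolP.
- by apply/asboolP => x; exact: le_trans (p23 x) (p12 x).
- have [[p0 Ap0]|A0] := pselect (A !=set0); last first.
    by exists q0 => p Ap; case: A0; exists p.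
  pose G x := [set s | exists2 p : T, A p & sval p x <= s].
  have Ginf x : has_inf (G x).
    split; first by exists (sval p0 x); exists p0.
    (* Every [p] in the chain satisfies [- q (- x) <= - p (- x) <= p x], so the pointwise infimum is
       finite. *)
    exists (- q (- x)) => s [p _]; apply: le_trans.
    have [ps pq] := svalP p.
    by rewrite (le_trans _ (sublinear_lower _ ps))// lerN2.
  have lbG x (p : T) : A p -> inf (G x) <= sval p x.
    by move=> Ap; apply: ge_inf; [case: (Ginf x)|exists p].
  have Gs : sublinear (fun x => inf (G x)).
    apply: sublinear_inf => //
      [x y s t [p Ap px] [p' Ap' p'y]|a x s a0 [p Ap px]].
      (* The smaller of two chain members bounds both terms, and its own subadditivity concludes. *)
      have [/asboolP le_p|/asboolP le_p] := Atot _ _ Ap Ap'.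
      + exists p' => //; have [[p'D _] _] := svalP p'.
        by have := p'D x y; have := le_p x; lra.
      + exists p => //; have [[pD _] _] := svalP p.
        by have := pD x y; have := le_p y; lra.
    exists p => //; have [ps _] := svalP p.
    by rewrite sublinearZ// ler_wpM2l.
  have Gq x : inf (G x) <= q x.
    by apply: le_trans (lbG x p0 Ap0) _; case: (svalP p0) => _; apply.
  pose g : T := @exist _ _ (fun x => inf (G x)) (conj Gs Gq).
  by exists g => p Ap; apply/asboolP => x; exact: lbG.
- exists p; split=> // p' p's p'p.
  have p'q x : p' x <= q x by exact: le_trans (p'p x) (pq x).
  have := pmin (@exist _ _ p' (conj p's p'q)).
  by move=> /(_ (asboolT p'p))/asboolP.
Qed.

Lemma minimal_sublinear_scalar p : sublinear p ->
  (forall p', sublinear p' -> (forall x, p' x <= p x) ->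
    forall x, p x <= p' x) ->
  scalar p.
Proof.
move=> ps pmin.
have pD x y : p (x + y) = p x + p y.
  apply/eqP; rewrite eq_le ps.1 /= -lerBrDr.
  have [p' [p's p'p p'y]] := sublinear_shrink y ps.
  exact: le_trans (pmin _ p's p'p x) (p'y x).
have pN x : p (- x) = - p x.
  by apply/eqP; rewrite -addr_eq0 -pD addNr sublinear0.
move=> a x y; rewrite pD; congr (_ + _).
have [a0|a0] := leP 0 a; first exact: sublinearZ.
have na0 : 0 <= - a by rewrite oppr_ge0 ltW.
by apply: oppr_inj; rewrite -pN -scaleNr sublinearZ// mulNr.
Qed.

(** Shrinking [q] at [x0] before minimising forces [f (- x0) <= - q x0]; this replaces prescribing
    [f] on the line through [x0]. *)
Theorem Hahn_Banach q x0 : sublinear q ->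
  exists f : {scalar V}, (forall x, f x <= q x) /\ f x0 = q x0.
Proof.
move=> qs.
have [p [ps pq px0]] := sublinear_shrink x0 qs.
have [f [fs fp fmin]] := exists_minimal_sublinear ps.
have fl := minimal_sublinear_scalar fs fmin.
pose F : {scalar V} := HB.pack f (GRing.isLinear.Build R V R *%R f fl).
have Fq x : F x <= q x by exact: le_trans (fp x) (pq x).
exists F; split=> //; apply/eqP; rewrite eq_le Fq /=.
have := le_trans (fp (- x0)) (px0 (- x0)).
by rewrite -[f _]/(F (- x0)) raddfN addNr sublinear0// sub0r lerN2.
Qed.

End HahnBanach.

(** * Separation of a point from a convex cone in a locally convex space *)

Section Separation.
Context (R : realType) (E : tvsType R).
Implicit Types (A C W : set E) (x y w : E).

(** The last clause is convexity in homogeneous form, as the gauge needs it; it follows by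
    normalising the weights to [t / (t + t')]. *)
Lemma convex_nbhs0 A : nbhs (0 : E) A ->
  exists W, [/\ nbhs (0 : E) W, W `<=` A &
    forall w w' (t t' : R), W w -> W w' -> 0 <= t -> 0 <= t' ->
      exists2 w'', W w'' & t *: w + t' *: w' = (t + t') *: w''].
Proof.
move=> A0; have [B Bconv [Bopen Bbasis]] := @locally_convex R E.
have [W [BW W0] WA] := Bbasis 0 A A0; exists W; split=> //.
  by apply: open_nbhs_nbhs; split=> //; exact: Bopen.
move=> w w' t t' Ww Ww' t0 t'0.
have [tt'|tt'] := eqVneq (t + t') 0.
  exists w => //; move: tt' => /eqP.
  rewrite paddr_eq0// => /andP[/eqP-> /eqP->].
  by rewrite !scale0r !addr0 scale0r.
have s0 : 0 < t + t' by rewrite lt_neqAle eq_sym tt' addr_ge0.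
have l0 : 0 <= t / (t + t') by rewrite divr_ge0// ltW.
have l1 : t / (t + t') <= 1 by rewrite ler_pdivrMr// mul1r lerDl.
have := Bconv W (mem_set BW) w w' (Itv01 l0 l1) (mem_set Ww) (mem_set Ww').
move/set_mem => Wc; eexists; first exact: Wc.
rewrite /conv /= scalerDr !scalerA /unstable.onem mulrBr mulr1.
by rewrite mulrCA divff// mulr1 addrAC subrr add0r.
Qed.

Lemma absorbing_nbhs0 W x : nbhs (0 : E) W -> exists2 r : R, 0 < r & W (r *: x).
Proof.
move=> W0; have := @scale_continuous R E (0, x) W.
rewrite /= scale0r => /(_ W0)[/= [B1 B2] [/= B10 B2x] BW].
have /nbhs_ballP[e /= e0 eB1] := B10.
exists (e / 2); first exact: divr_gt0.
apply: (BW (e / 2, x)); split => /=; last exact: nbhs_singleton B2x.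
by apply: eB1; rewrite /ball/= sub0r normrN gtr0_norm ?divr_gt0//; lra.
Qed.

Lemma bounded_above_scalar_continuous (f : {scalar E}) W :
  nbhs (0 : E) W -> (forall w, W w -> f w <= 1) -> continuous f.
Proof.
move=> W0 fW z; apply/cvgrPdist_lt => e e0.
have e2 : e / 2 != 0 :> R by rewrite lt0r_neq0// divr_gt0.
(* On the symmetric set [W] intersected with [- W], the one-sided bound becomes [|f w| <= 1];
   scaling by [e / 2] then gives a strict bound by [e]. *)
have WN : nbhs (0 : E) (W `&` (-%R @` W)).
  by apply: filterI => //; exact: nbhs0N.
apply: (@filterS _ _ (nbhs_filter (z : E)) _ _ _ (nbhsT z (nbhs0Z e2 WN))).
move=> _ /= [_ [w [Ww [w' Ww' w'w]] <-] <-].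
rewrite linearD opprD addrA subrr add0r normrN linearZ/=.
have := fW _ Ww; have := fW _ Ww'; rewrite -[w']opprK w'w linearN => fNw fw.
rewrite normrM gtr0_norm ?divr_gt0//.
have : `|f w| <= 1 by rewrite ler_norml; lra.
nra.
Qed.

Theorem cone_separation C x :
  C 0 -> (forall y z, C y -> C z -> C (y + z)) ->
  (forall (a : R) y, 0 <= a -> C y -> C (a *: y)) ->
  ~ closure C x ->
  exists f : {scalar E}, [/\ continuous f, forall y, C y -> f y <= 0 & 0 < f x].
Proof.
move=> C0 CD CZ /existsNP[A /not_implyP[Ax CA]].
have A0 : nbhs (0 : E) [set w | A (x - w)].
  have := nbhsB x (nbhsN_subproof (@scale_continuous R E) Ax).
  rewrite subrr; apply: filterS => _ [_ [a Aa <-] <-] /=.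
  by rewrite opprB subrKC.
have [W [W0 WA Wconv]] := convex_nbhs0 A0.
pose G y := [set t : R | 0 <= t /\ exists c w, [/\ C c, W w & y = c + t *: w]].
have Ginf y : has_inf (G y).
  split; last by exists 0 => t [].
  have [r r0 Wr] := absorbing_nbhs0 y W0.
  exists r^-1; split; first by rewrite invr_ge0 ltW.
  exists 0, (r *: y); split=> //.
  by rewrite add0r scalerA mulVf ?scale1r// lt0r_neq0.
have G_lb y t : G y t -> inf (G y) <= t.
  by move=> Gt; apply: ge_inf => //; case: (Ginf y).
have qs : sublinear (fun y => inf (G y)).
  apply: sublinear_inf => //.
    move=> y z s t [s0 [c [w [Cc Ww ->]]]] [t0 [c' [w' [Cc' Ww' ->]]]].
    split; first exact: addr_ge0.
    have [w'' Ww'' E''] := Wconv w w' s t Ww Ww' s0 t0.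
    exists (c + c'), w''; split => //; first exact: CD.
    by rewrite -E'' addrACA.
  move=> a y s a0 [s0 [c [w [Cc Ww ->]]]].
  split; first exact: mulr_ge0.
  exists (a *: c), w; split => //; first exact: CZ.
  by rewrite scalerDr scalerA.
have [f [fq fx]] := Hahn_Banach x qs.
exists f; split.
- apply: (bounded_above_scalar_continuous W0) => w Ww.
  apply: le_trans (fq w) (G_lb _ _ _); split=> //.
  by exists 0, w; rewrite add0r scale1r.
- move=> y Cy; apply: le_trans (fq y) (G_lb _ _ _); split=> //.
  by exists y, 0; rewrite scale0r addr0; split=> //; exact: nbhs_singleton W0.
- rewrite fx (lt_le_trans ltr01)//; apply: lb_le_inf; first by case: (Ginf x).
  (* If [x = c + t *: w] with [t < 1], then [t *: w + (1 - t) *: 0] lies in [W], so [c] is in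
     [x - W], hence in [A], which misses [C]. *)
  move=> t [t0 [c [w [Cc Ww xE]]]]; rewrite leNgt; apply/negP => t1.
  apply: CA; exists c; split=> //.
  have t1' : 0 <= 1 - t by rewrite subr_ge0 ltW.
  have [w'' Ww'' E''] := Wconv w 0 t (1 - t) Ww (nbhs_singleton W0) t0 t1'.
  have := WA _ Ww''; rewrite /= -[w'']scale1r -[1](subrKC t) -E''.
  by rewrite scaler0 addr0 xE addrK.
Qed.

End Separation.

Lemma continuous_le0_closure (R : realType) (E : topologicalType) (f : E -> R)
    (C : set E) :
  continuous f -> (forall y, C y -> f y <= 0) ->
  forall x, closure C x -> f x <= 0.
Proof.
move=> fcont fC x Cx; rewrite leNgt; apply/negP => fx.
have [y [Cy]] := Cx _ (cvgr_gt _ (fcont x) _ fx).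
by rewrite /= ltNge fC.
Qed.

(** * The cone of claims and the equivalence *)

Section Claims.
Context (R : realType) (V : vectorLatticeType R) (P : pred V).
Variable U : subLcTopVectorLatticeType P.
Context (K0 : set V) (hK0 : convex_cone K0).

Lemma convex_cone0 : K0 0.
Proof.
have [[k K0k] /(_ 0 0 k k (lexx 0) (lexx 0) K0k K0k)] := hK0.
by rewrite !scale0r addr0.
Qed.

(** This makes a functional that is nonpositive on the claims positive: [- x = 0 - x] with [0] in
    [K0]. *)
Lemma claimsN (x : U) : positive_cone U x -> claims U K0 (- x).
Proof.
move=> x0; exists 0; first exact: convex_cone0.
exists (\val x); last by rewrite sub0r raddfN.
by have := x0; rewrite /positive_cone /= -Order.le_val raddf0.
Qed.

Lemma claims_comb (a b : R) (x y : U) : 0 <= a -> 0 <= b ->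
  claims U K0 x -> claims U K0 y -> claims U K0 (a *: x + b *: y).
Proof.
move=> a0 b0 [k K0k [v v0 xE]] [k' K0k' [v' v'0 yE]].
exists (a *: k + b *: k'); first exact: hK0.2.
exists (a *: v + b *: v').
  have bv0 : 0 <= b *: v' by exact: vl_scaler_ge0.
  have av0 : 0 <= a *: v by exact: vl_scaler_ge0.
  by have := vl_lerD _ _ (b *: v') av0; rewrite add0r; exact: le_trans bv0.
rewrite [RHS]GRing.valD !GRing.valZ.
by rewrite -xE -yE !scalerBr opprD addrACA.
Qed.

End Claims.

Theorem theorem4p4 (R : realType) (V : topVectorLatticeType R)
    (K0 : set V) (hK0 : convex_cone K0)
    (I : set V) (hI : ideal I) (hIdense : dense I)
    (U : subLcTopVectorLatticeType (fun x : V => x \in I)) :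
  NFL U K0 <->
  (forall x : U, positive_cone U x -> x <> 0 ->
     exists f : {scalar U}, separating (claims U K0) f /\ 0 < f x).
Proof.
have U0 : positive_cone U 0 by exact: lexx.
have C0 : claims U K0 0 by rewrite -oppr0; exact: claimsN.
split=> [nfl x x0 xn0|sep].
- have [||||f [fcont fC fx]] := @cone_separation R U (claims U K0) x.
  + exact: C0.
  + move=> y z Cy Cz; rewrite -[y]scale1r -[z]scale1r.
    exact: claims_comb.
  + move=> a y a0 Cy; rewrite -[_ *: _]addr0 -(scaler0 _ 0).
    exact: claims_comb.
  + by move=> Cx; apply: xn0; have : [set 0] x by rewrite -nfl.
  exists f; split=> //; split=> //; split=> // y y0.
  by have := fC _ (claimsN hK0 y0); rewrite raddfN oppr_le0.
- apply/seteqP; split=> [x [Cx x0]|_ ->]; last first.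
    by split=> //; exact: subset_closure.
  apply: contrapT => /(sep x x0)[f [[[fcont _] fC]]].
  by rewrite ltNge (continuous_le0_closure fcont fC).
Qed.
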